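(* Let $k\geq 3$ and $n\geq 1$ be integers. All $(k,n)$-accordions have the same number of spanning trees; denote this common number by $\tau(A(k,n))$. Moreover, for all integers $k\geq 3$ and $n\geq 3$, \[ \tau(A(k,n))=k\cdot \tau(A(k,n-1))-\tau(A(k,n-2)). \]
   Context: For integers $k\geq 3$, $n\geq 1$, a $(k,n)$-accordion is any graph $A_n$ obtained as follows. (i) Let $A_1$ be a $k$-cycle $C^k_1$, embedded in the plane, and designate all its edges as free. (ii) For $i=2,\ldots,n$: choose a free edge $(r,s)$ of $A_{i-1}$ and add a new $k$-cycle $C^k_i$ that consists of the edge $(r,s)$ together with a path of $k-1$ edges through $k-2$ new nodes from $r$ to $s$, such that the resulting graph $A_i$ is planar embedded; designate as free exactly the edges incident to a new node of this step. The number of spanning trees of a graph $G$ is denoted $\tau(G)$. *)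

(* Defs.v *)
From HB Require Import structures.
From mathcomp Require Import all_boot all_order all_algebra.

Set Implicit Arguments.
Unset Strict Implicit.
Unset Printing Implicit Defensive.

(* A finite simple graph whose vertices are taken from an ambient finite type;
   the vertex set may be a proper subset of T, so that a graph and the larger
   graphs built from it by adding new vertices share the same type. *)
Record sgraph (T : finType) := SGraph {
  vertices : {set T};
  edges : {set {set T}};
  edgesP : forall e, e \in edges -> e \subset vertices /\ #|e| = 2 }.

Definition adj (T : finType) (F : {set {set T}}) : rel T :=
  fun x y => [set x; y] \in F.

Definition connected (T : finType) (V : {set T}) (F : {set {set T}}) : bool :=
  [forall x in V, forall y in V, connect (adj F) x y].

(* The vertices of a cycle are pairwise distinct, so its length is at most
   #|T|; the bound only serves to make the quantification finite. *)
Definition acyclic (T : finType) (F : {set {set T}}) : bool :=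
  [forall m : 'I_#|T|.+1, forall c : m.-tuple T,
     ~~ [&& 2 < m, uniq c & cycle (adj F) c]].

Lemma acyclicP (T : finType) (F : {set {set T}}) :
  reflect (forall c : seq T, 2 < size c -> uniq c -> ~~ cycle (adj F) c)
          (acyclic F).
Proof.
apply: (iffP forallP) => [acF c c_gt2 Uc | acF m].
  have lt_c : size c < #|T|.+1 by rewrite ltnS -(card_uniqP Uc) max_card.
  have /forallP/(_ (in_tuple c)) := acF (Ordinal lt_c).
  by rewrite /= c_gt2 Uc.
apply/forallP=> c; apply/negP=> /and3P[m_gt2 Uc].
by apply/negP/acF; rewrite ?size_tuple.
Qed.

Definition tree (T : finType) (V : {set T}) (F : {set {set T}}) : bool :=
  connected V F && acyclic F.

Definition tau (T : finType) (G : sgraph T) : nat :=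
  #|[set F : {set {set T}} | (F \subset edges G) && tree (vertices G) F]|.

(* The edges joining consecutive vertices of the walk x :: p. *)
Definition walk_edges (T : finType) (x : T) (p : seq T) : {set {set T}} :=
  [set [set d.1; d.2] | d in zip (x :: p) p].

(* accordion_free k n G fr: G is a (k, n)-accordion in which fr is the set of
   edges that are currently free.
   The planar embedding that accompanies the construction is not recorded: it
   does not restrict which graphs arise, because in any planar embedding of G
   the new path can be drawn alongside the edge {r, s}, inside a face incident
   to that edge. *)
Inductive accordion_free (T : finType) (k : nat) :
    nat -> sgraph T -> {set {set T}} -> Prop :=
| AccordionCycle (G : sgraph T) (x : T) (p : seq T) :
    uniq (x :: p) -> size (x :: p) = k ->
    vertices G = [set y in x :: p] ->
    edges G = walk_edges x (rcons p x) ->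
    accordion_free k 1 G (edges G)
| AccordionStep (n : nat) (G G' : sgraph T) (fr : {set {set T}})
    (r s : T) (p : seq T) :
    accordion_free k n G fr ->
    [set r; s] \in fr ->
    uniq p -> size p = k - 2 -> [disjoint p & vertices G] ->
    vertices G' = vertices G :|: [set y in p] ->
    edges G' = edges G :|: walk_edges r (rcons p s) ->
    accordion_free k n.+1 G' [set e in edges G' | [exists y in e, y \in p]].

Definition accordion (T : finType) (k n : nat) (G : sgraph T) : Prop :=
  exists fr : {set {set T}}, accordion_free k n G fr.

(* Main.v *)
Require Import Defs.
From HB Require Import structures.
From mathcomp Require Import all_boot all_order all_algebra.

Set Implicit Arguments.
Unset Strict Implicit.
Unset Printing Implicit Defensive.

(** Let [t] be the number of spanning trees of a graph and [c] the number of
    those through a given edge [rs], that is, of spanning forests with two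
    components that separate [r] from [s]. Growing a path from [r] one pendant
    vertex at a time keeps [t] and adds [t] to [c]; closing the path at [s] adds
    [c] to [t]. Hence an ear with [k - 1] edges on [rs] gives [(k - 1) t + c]
    spanning trees. Deleting any edge of the ear leaves pendant paths, so exactly
    [t] of these trees avoid it; the number of trees avoiding a free edge is thus
    the number of spanning trees of the previous accordion, and
    [t' = k t - t_previous]. The initial cycle is an ear with [r = s] on a single
    vertex. *)

(** * Counting the subsets of a finite set that satisfy a predicate *)

Definition subset_count (U : finType) (E : {set U}) (P : pred {set U}) : nat :=
  #|[set F : {set U} | (F \subset E) && P F]|.

Lemma eq_subset_count (U : finType) (E : {set U}) (P Q : pred {set U}) :
  (forall F : {set U}, F \subset E -> P F = Q F) ->
  subset_count E P = subset_count E Q.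
Proof.
move=> eqPQ; apply: eq_card => F; rewrite !inE.
by case: (boolP (F \subset E)) => // /eqPQ.
Qed.

Lemma subset_count_pred0 (U : finType) (E : {set U}) (P : pred {set U}) :
  (forall F : {set U}, F \subset E -> P F = false) -> subset_count E P = 0.
Proof.
move=> P0; apply/eqP; rewrite cards_eq0; apply/eqP/setP=> F; rewrite !inE.
by case: (boolP (F \subset E)) => // /P0.
Qed.

(** Subsets without [e] give the first summand; removing [e] is a bijection from the others onto
    subsets of [E]. *)
Lemma subset_count_setU1 (U : finType) (e : U) (E : {set U}) (P : pred {set U}) :
  e \notin E ->
  subset_count (e |: E) P
  = subset_count E P + subset_count E (fun F => P (e |: F)).
Proof.
move=> eE; rewrite /subset_count.
pose A := [set F : {set U} | (F \subset e |: E) && P F].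
rewrite -[LHS]/(#|A|) -(cardsID [set F : {set U} | e \notin F] A).
congr (_ + _).
  apply: eq_card => F; rewrite !inE.
  apply/andP/andP=> [[/andP[sFE PF] eF]|[sFE PF]].
    split=> //; apply/subsetP=> f fF; have := subsetP sFE f fF.
    by rewrite !inE => /orP[/eqP fe|//]; rewrite -fe fF in eF.
  split; last by apply: contra eE; apply: (subsetP sFE).
  by rewrite PF andbT (subset_trans sFE) ?subsetUr.
pose B := [set F : {set U} | (F \subset E) && P (e |: F)].
have injB : {in B &, injective (fun F => e |: F)}.
  move=> F1 F2; rewrite !inE => /andP[s1 _] /andP[s2 _] eqF.
  have e1 : e \notin F1 by apply: contra eE; apply: (subsetP s1).
  have e2 : e \notin F2 by apply: contra eE; apply: (subsetP s2).
  by rewrite -(setU1K e1) -(setU1K e2) eqF.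
rewrite -[RHS]/(#|B|) -(card_in_imset injB); apply: eq_card => F; rewrite !inE negbK.
apply/idP/imsetP=> [/and3P[eF sFE PF]|[F0]].
  exists (F :\ e); last by rewrite setD1K.
  by rewrite inE setD1K // PF andbT subDset.
rewrite !inE => /andP[sF PF] ->.
by rewrite PF setU11 setUS.
Qed.

(** * Spanning trees and two-component forests under edge addition *)

Section Forests.

Variable T : finType.
Implicit Types (x y z r s u v : T) (V : {set T}) (E F : {set {set T}}).

Lemma adj_sym F : symmetric (adj F).
Proof. by move=> x y; rewrite /adj setUC. Qed.

Lemma connect_adj_sym F : connect_sym (adj F).
Proof. exact/sym_connect_sym/adj_sym. Qed.

Lemma sub_adj F F' : F \subset F' -> subrel (adj F) (adj F').
Proof. by move=> sF x y; apply: (subsetP sF). Qed.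

Lemma eq_set2 x y u v : [set x; y] = [set u; v] ->
  (x = u /\ y = v) \/ (x = v /\ y = u).
Proof.
move=> eqs.
have: x \in [set u; v] by rewrite -eqs set21.
have: y \in [set u; v] by rewrite -eqs set22.
have: u \in [set x; y] by rewrite eqs set21.
have: v \in [set x; y] by rewrite eqs set22.
rewrite !inE => /orP[]/eqP-> /orP[]/eqP-> /orP[]/eqP ? /orP[]/eqP ?; subst; auto.
Qed.

(** A walk needs to cross the new edge at most once; the last two disjuncts are the two directions
    of that crossing. *)
Lemma connect_setU1 x y F u v :
  connect (adj ([set x; y] |: F)) u v =
  [|| connect (adj F) u v,
      connect (adj F) u x && connect (adj F) y v
    | connect (adj F) u y && connect (adj F) x v].
Proof.
have sub : subrel (connect (adj F)) (connect (adj ([set x; y] |: F))).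
  apply: connect_sub => a b ab; apply: connect1.
  exact: (sub_adj (subsetUr _ _)) ab.
have xy : connect (adj ([set x; y] |: F)) x y by apply: connect1; apply: setU11.
have yx : connect (adj ([set x; y] |: F)) y x by rewrite connect_adj_sym.
apply/idP/or3P=> [/connectP[p]|]; last first.
  case=> [/sub //|/andP[/sub ux /sub yv]|/andP[/sub uy /sub xv]].
    exact: connect_trans ux (connect_trans xy yv).
  exact: connect_trans uy (connect_trans yx xv).
elim: p u => [|w p IHp] u /=; first by move=> _ ->; constructor.
case/andP=> uw wp vE; have {IHp wp vE} := IHp w wp vE.
move: uw; rewrite /adj in_setU1 => /orP[/eqP/eq_set2[]|] .
- case=> -> -> [yv|/andP[_ yv]|/andP[_ xv]].
  + by apply: Or32; rewrite connect0.
  + by apply: Or32; rewrite connect0.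
  + by apply: Or31.
- case=> -> -> [xv|/andP[_ yv]|/andP[_ xv]].
  + by apply: Or33; rewrite connect0.
  + by apply: Or31.
  + by apply: Or33; rewrite connect0.
move/(@connect1 _ (adj F)) => uw.
case=> [wv|/andP[wx yv]|/andP[wy xv]].
- by apply: Or31; apply: connect_trans uw wv.
- by apply: Or32; rewrite yv andbT; apply: connect_trans uw wx.
- by apply: Or33; rewrite xv andbT; apply: connect_trans uw wy.
Qed.

Lemma acyclicS F F' : F \subset F' -> acyclic F' -> acyclic F.
Proof.
move=> sF /acyclicP acF; apply/acyclicP=> c c2 Uc.
by apply: contra (acF c c2 Uc); apply: sub_cycle; apply: sub_adj.
Qed.

(** Every step starts in [u :: q], which contains neither end of the new edge, and the path meets
    [a] only at its end. *)
Lemma path_adj_setU1 a b F u q :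
  a \notin u :: q -> b \notin u :: q ->
  path (adj ([set a; b] |: F)) u (rcons q a) -> path (adj F) u (rcons q a).
Proof.
elim: q u => [|w q IHq] u /=; rewrite !inE ?negb_or.
  rewrite andbT /adj in_setU1 => au bu /orP[/eqP/eq_set2|->//].
  by case=> -[ua _]; rewrite ua eqxx in au bu.
case/andP=> au aq /andP[bu bq] /andP[uw wp].
rewrite IHq ?inE ?negb_or // andbT.
move: uw; rewrite /adj in_setU1 => /orP[/eqP/eq_set2|->//].
by case=> -[ua _]; rewrite ua eqxx in au bu.
Qed.

Lemma acyclic_setU1 x y F : x != y -> [set x; y] \notin F ->
  acyclic ([set x; y] |: F) = acyclic F && ~~ connect (adj F) x y.
Proof.
move=> neq_xy xyF; apply/idP/andP=> [acF|[acF nxy]].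
  split; first exact: acyclicS (subsetUr _ _) acF.
  apply/negP=> /connectP[p0 Fp0 yE].
  case/shortenP: Fp0 yE => p Fp Up _ yE.
  (* A one-step path would be the edge [[set x; y]] of [F]; hence the path and the new edge close up
     to a genuine cycle. *)
  have p_gt1 : 1 < size p.
    case: p Fp Up yE => [|w [|w' p]] //=.
      by move=> _ _ xE; rewrite xE eqxx in neq_xy.
    by rewrite andbT /adj => xw _ yE; rewrite yE xw in xyF.
  have /acyclicP/(_ (x :: p) p_gt1 Up)/negP := acF; apply.
  rewrite /= rcons_path -yE (sub_path (sub_adj (subsetUr _ _)) Fp) /=.
  by rewrite adj_sym /adj setU11.
apply/acyclicP=> c c_gt2 Uc; apply/negP=> cyc.
have /acyclicP/(_ c c_gt2 Uc) ncyc := acF.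
(* Some step of [c], from [a] to its successor [b], is the new edge. Rotating [c] to start at [a]
   turns the rest into a path from [b] back to [a]. *)
case: (boolP [forall a in c, adj F a (next c a)]) => [/forallP all_a|].
  case/negP: ncyc; apply: cycle_from_next => // a ac.
  by have /implyP/(_ ac) := all_a a.
case/forallPn=> a; rewrite negb_imply => /andP[ac na].
have := next_cycle cyc ac.
rewrite {1}/adj in_setU1 (negPf (na : [set a; next c a] \notin F)) orbF => /eqP ab.
have [i c' rot_c] := rot_to ac.
have : next (a :: c') a = next c a by rewrite -rot_c next_rot.
have : cycle (adj ([set x; y] |: F)) (a :: c') by rewrite -rot_c rot_cycle.
have : uniq (a :: c') by rewrite -rot_c rot_uniq.
have : 2 < size (a :: c') by rewrite -rot_c size_rot.
case: c' {rot_c} => [|b [|w q]] //= _ Uabw.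
rewrite eqxx => cyc' bE; move: ab; rewrite -bE => ab.
have ba : connect (adj F) b a.
  case/and3P: cyc' => _ bw wp; apply/connectP; exists (w :: rcons q a); last first.
    by rewrite /= last_rcons.
  (* [path_adj_setU1] handles the walk from [w] to [a]. The step from [b] to [w] starts at an end of
     the new edge, so it is checked separately: [w] is neither [a] nor [b]. *)
  move: Uabw; rewrite !inE !negb_or => /and4P[/and3P[ab' aw aq] /andP[bw' bq] _ _].
  rewrite -ab in bw wp.
  rewrite /= (path_adj_setU1 (b := b) _ _ wp) ?inE ?negb_or ?aw ?bw' //.
  rewrite andbT; move: bw; rewrite /adj in_setU1 => /orP[/eqP/eq_set2|//].
  case=> [[_ wb]|[_ wa]]; first by rewrite wb eqxx in bw'.
  by rewrite wa eqxx in aw.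
case/negP: nxy.
by case: (eq_set2 ab) ba => -[-> ->] //; rewrite connect_adj_sym.
Qed.

Definition within V F := forall e : {set T}, e \in F -> e \subset V.

Lemma withinS V F F' : F' \subset F -> within V F -> within V F'.
Proof. by move=> sF wF e /(subsetP sF)/wF. Qed.

Lemma connect_outside V F z v :
  within V F -> z \notin V -> connect (adj F) z v = (z == v).
Proof.
move=> wF zV; apply/idP/eqP=> [/connectP[[|w p] /=]|->]; [by []| |exact: connect0].
case/andP=> /wF; rewrite subUset sub1set => /andP[zV' _].
by rewrite zV' in zV.
Qed.

(* Spanning forests of [V] with exactly two components, one containing [r] and
   the other [s]; they are the trees through the edge [rs] with it removed. *)
Definition bitree r s V F : bool :=
  [&& acyclic F, ~~ connect (adj F) r s
    & [forall v in V, connect (adj F) v r || connect (adj F) v s]].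

Lemma bitree_edge r s V F : bitree r s V F -> [set r; s] \notin F.
Proof. by case/and3P=> _ rs _; apply: contra rs => /(@connect1 _ (adj F)). Qed.

Lemma bitree_diag r V F : bitree r r V F = false.
Proof. by rewrite /bitree connect0 andbF. Qed.

Lemma connectedP V F r : r \in V ->
  reflect {in V, forall v, connect (adj F) v r} (connected V F).
Proof.
move=> rV; apply: (iffP forall_inP) => [cV v vV|cV u uV].
  by have /forall_inP := cV v vV; apply.
apply/forall_inP=> v vV; apply: connect_trans (cV u uV) _.
by rewrite connect_adj_sym cV.
Qed.

(** Once [rs] is added, reaching [r] amounts to having reached [r] or [s] before, and acyclicity
    forces [r] and [s] to have been separated. *)
Lemma tree_setU1 r s V F : r \in V -> r != s -> [set r; s] \notin F ->
  tree V ([set r; s] |: F) = bitree r s V F.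
Proof.
move=> rV neq_rs rsF; rewrite /tree acyclic_setU1 // /bitree andbC -andbA.
congr (_ && _); case: (boolP (connect _ r s)) => //= nrs.
  apply/(connectedP _ rV)/forall_inP.
  move=> cV v /cV; rewrite connect_setU1 !(connect_adj_sym F s r).
  by case/or3P=> [->|/andP[-> _]|/andP[-> _]]; rewrite ?orbT.
move=> cV v /cV; rewrite connect_setU1 connect0 andbT.
by case/orP=> ->; rewrite ?orbT.
Qed.

Lemma tree_pendant r z V F : r \in V -> z \notin V -> within V F ->
  tree (z |: V) ([set r; z] |: F) = tree V F.
Proof.
move=> rV zV wF.
have neq_rz : r != z by apply: contraNneq zV => <-.
have rzF : [set r; z] \notin F.
  by apply: contra zV => /wF; rewrite subUset !sub1set => /andP[].
have rV' : r \in z |: V by rewrite !inE rV orbT.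
have nz v : connect (adj F) z v = (z == v) by apply: connect_outside wF zV.
rewrite /tree acyclic_setU1 // (connect_adj_sym F r) nz (eq_sym z) neq_rz andbT.
congr (_ && _); apply/(connectedP _ rV')/(connectedP _ rV) => cV v.
  move=> vV; have := cV v; rewrite inE vV orbT connect_setU1 => /(_ isT).
  rewrite nz (eq_sym z) (negPf neq_rz) andbF orFb connect0 andbT.
  rewrite (connect_adj_sym F v z) nz orbC; case: eqP => [zv|_ //].
  by rewrite zv vV in zV.
rewrite connect_setU1 connect0 andbT.
by case/setU1P=> [->|/cV -> //]; rewrite connect0 !orbT.
Qed.

Lemma tree_outside r z V F : r \in V -> z \notin V -> within V F ->
  tree (z |: V) F = false.
Proof.
move=> rV zV wF; apply/negP=> /andP[/forall_inP/(_ z (setU11 _ _))/forall_inP/(_ r)].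
rewrite inE rV orbT (connect_outside _ wF zV) => /(_ isT)/eqP zr.
by rewrite zr rV in zV.
Qed.

(** The leaf [z] hangs on [r], so it takes over the role of [r] as representative of its
    component. *)
Lemma bitree_pendant r s z V F :
  r \in V -> s \in V -> z \notin V -> within V F ->
  bitree z s (z |: V) ([set r; z] |: F) = bitree r s V F.
Proof.
move=> rV sV zV wF.
have neq_rz : r != z by apply: contraNneq zV => <-.
have neq_sz : s != z by apply: contraNneq zV => <-.
have rzF : [set r; z] \notin F.
  by apply: contra zV => /wF; rewrite subUset !sub1set => /andP[].
have nz v : connect (adj F) z v = (z == v) by apply: connect_outside wF zV.
have nz' v : connect (adj F) v z = (z == v) by rewrite connect_adj_sym nz.
have nf v : v \in V -> (z == v) = false.
  by move=> vV; apply: contraNF zV => /eqP->.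
rewrite /bitree acyclic_setU1 // nz' nf // andbT; congr [&& _, _ & _].
  by rewrite connect_setU1 !nz (nf s) // (nf r) // eqxx.
have eqv v : v \in V -> connect (adj ([set r; z] |: F)) v z = connect (adj F) v r.
  by move=> vV; rewrite connect_setU1 !nz' (nf v) // eqxx andbT orbF.
have eqs v : v \in V -> connect (adj ([set r; z] |: F)) v s = connect (adj F) v s.
  by move=> vV; rewrite connect_setU1 !nz' !nz (nf v) // (nf s) // andbF orbF.
apply/forall_inP/forall_inP=> cV v.
  by move=> vV; rewrite -eqv // -eqs // cV // inE vV orbT.
by case/setU1P=> [->|vV]; rewrite ?connect0 // eqv // eqs // cV.
Qed.

(** The isolated vertex [z] is a component by itself, so the other component has to span [V]. *)
Lemma bitree_outside s z V F : s \in V -> z \notin V -> within V F ->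
  bitree z s (z |: V) F = tree V F.
Proof.
move=> sV zV wF.
have nz v : connect (adj F) z v = (z == v) by apply: connect_outside wF zV.
have nf v : v \in V -> (z == v) = false.
  by move=> vV; apply: contraNF zV => /eqP->.
rewrite /bitree /tree nz nf //= andbC; congr (_ && _).
apply/forall_inP/(connectedP _ sV) => cV v.
  by move=> vV; have := cV v; rewrite inE vV orbT connect_adj_sym nz nf //; apply.
by case/setU1P=> [->|/cV ->]; rewrite ?connect0 ?orbT.
Qed.

(** * Counts of trees and of two-component forests *)

Definition ntrees V E := subset_count E (tree V).
Definition nbitrees r s V E := subset_count E (bitree r s V).

(** Deletion and contraction, with two-component forests standing for the spanning trees of the
    contracted graph. *)
Lemma ntrees_setU1 r s V E : r \in V -> r != s -> [set r; s] \notin E ->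
  ntrees V ([set r; s] |: E) = ntrees V E + nbitrees r s V E.
Proof.
move=> rV neq_rs rsE; rewrite /ntrees subset_count_setU1 //; congr (_ + _).
apply: eq_subset_count => F sF; apply: tree_setU1 => //.
by apply: contra rsE; apply: (subsetP sF).
Qed.

Lemma nbitrees_setU1 r s V E : [set r; s] \notin E ->
  nbitrees r s V ([set r; s] |: E) = nbitrees r s V E.
Proof.
move=> rsE; rewrite /nbitrees subset_count_setU1 //.
rewrite [X in _ + X]subset_count_pred0 ?addn0 // => F _.
by apply/negP=> /bitree_edge; rewrite setU11.
Qed.

Lemma fresh_pendant r z V E : z \notin V -> within V E -> [set r; z] \notin E.
Proof.
by move=> zV wE; apply: contra zV => /wE; rewrite subUset !sub1set => /andP[].
Qed.

Lemma ntrees_pendant r z V E : r \in V -> z \notin V -> within V E ->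
  ntrees (z |: V) ([set r; z] |: E) = ntrees V E.
Proof.
move=> rV zV wE; rewrite /ntrees subset_count_setU1; last first.
  exact: fresh_pendant zV wE.
rewrite subset_count_pred0 => [|F /withinS/(_ wE) wF]; last first.
  exact: tree_outside rV zV wF.
by apply: eq_subset_count => F /withinS/(_ wE); apply: tree_pendant.
Qed.

Lemma nbitrees_pendant r s z V E :
  r \in V -> s \in V -> z \notin V -> within V E ->
  nbitrees z s (z |: V) ([set r; z] |: E) = ntrees V E + nbitrees r s V E.
Proof.
move=> rV sV zV wE; rewrite /nbitrees subset_count_setU1; last first.
  exact: fresh_pendant zV wE.
congr (_ + _); apply: eq_subset_count => F /withinS/(_ wE).
  exact: bitree_outside.
exact: bitree_pendant.
Qed.

End Forests.

(** * Edge sets of walks and pendant paths *)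

Section Ears.

Variable T : finType.
Implicit Types (x y z r s u v : T) (p q : seq T).
Implicit Types (V : {set T}) (E F : {set {set T}}).

Lemma walk_edges_nil x : walk_edges x [::] = set0.
Proof. by apply/setP=> e; rewrite inE; apply/imsetP=> -[]. Qed.

Lemma walk_edges_cons x y p :
  walk_edges x (y :: p) = [set x; y] |: walk_edges y p.
Proof.
apply/setP=> e; rewrite in_setU1; apply/imsetP/orP=> [[d]|].
  rewrite inE => /orP[/eqP->->|dp ->]; [by left | right].
  exact: imset_f.
case=> [/eqP->|/imsetP[d dp ->]]; [exists (x, y) | exists d] => //.
  by rewrite inE eqxx.
by rewrite inE dp orbT.
Qed.

Lemma walk_edges_cat x p q :
  walk_edges x (p ++ q) = walk_edges x p :|: walk_edges (last x p) q.
Proof.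
elim: p x => [|y p IHp] x /=; first by rewrite walk_edges_nil set0U.
by rewrite !walk_edges_cons IHp setUA.
Qed.

Lemma walk_edges_rcons x p y :
  walk_edges x (rcons p y) = [set last x p; y] |: walk_edges x p.
Proof.
by rewrite -cats1 walk_edges_cat walk_edges_cons walk_edges_nil setU0 setUC.
Qed.

Lemma walk_edges_rev x p y :
  walk_edges x (rcons p y) = walk_edges y (rcons (rev p) x).
Proof.
elim: p x => [|w p IHp] x /=.
  by rewrite !walk_edges_cons !walk_edges_nil (setUC [set x]).
rewrite walk_edges_cons IHp rev_cons (walk_edges_rcons y (rcons _ w)) last_rcons.
by rewrite (setUC [set x]).
Qed.

(** Singles out one edge of the ear; what remains is a path growing from [r] and one growing from
    [s]. The defaults of [last] and [head] cover the first and the last edge. *)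
Lemma walk_edges_split r s p q :
  walk_edges r (rcons (p ++ q) s)
  = [set last r p; head s q] |: (walk_edges r p :|: walk_edges s (rev q)).
Proof.
rewrite rcons_cat walk_edges_cat; case: q => [|v q] /=.
  by rewrite walk_edges_cons !walk_edges_nil !setU0 setUC.
by rewrite walk_edges_cons walk_edges_rev rev_cons setUCA.
Qed.

Lemma walk_edges_rconsP r s p e :
  e \in walk_edges r (rcons p s) ->
  exists p1 p2, p = p1 ++ p2 /\ e = [set last r p1; head s p2].
Proof.
elim: p r => [|w p IHp] r /=; rewrite walk_edges_cons in_setU1 => /orP[/eqP->|].
- by exists [::], [::].
- by rewrite walk_edges_nil inE.
- by exists [::], (w :: p).
by case/IHp=> p1 [p2 [-> ->]]; exists (w :: p1), p2.
Qed.

Lemma walk_edges_within x p : within [set y in x :: p] (walk_edges x p).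
Proof.
elim: p x => [|w p IHp] x e; first by rewrite walk_edges_nil inE.
rewrite walk_edges_cons in_setU1 => /orP[/eqP->|/IHp sep].
  by rewrite subUset !sub1set !inE !eqxx !orbT.
by apply: subset_trans sep _; apply/subsetP=> y; rewrite !inE => ->; rewrite orbT.
Qed.

Lemma card_walk_edges x p e : uniq (x :: p) -> e \in walk_edges x p -> #|e| = 2.
Proof.
elim: p x => [|w p IHp] x; first by rewrite walk_edges_nil inE.
rewrite cons_uniq => /andP[xp Up]; rewrite walk_edges_cons in_setU1.
case/orP=> [/eqP->|]; last exact: IHp.
by rewrite cards2; move: xp; rewrite inE negb_or => /andP[->].
Qed.

(** Only the first edge of the path contains [r], and the last vertex differs from the second.
    Needed for ears that close up at their starting vertex. *)
Lemma walk_edges_chord r p : uniq (r :: p) -> 1 < size p ->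
  [set last r p; r] \notin walk_edges r p.
Proof.
case: p => [|y [|w q]] //; rewrite cons_uniq => /andP[rp Up] _.
rewrite walk_edges_cons in_setU1 negb_or; apply/andP; split; last first.
  apply: contra rp => /walk_edges_within/subsetP/(_ r).
  by rewrite set22 inE; apply.
apply/eqP=> /eq_set2[[_ ry]|[ly _]]; first by rewrite ry mem_head in rp.
by move: Up; rewrite cons_uniq -{1}ly /= mem_last.
Qed.

Lemma within_setU V W E F :
  within V E -> within W F -> within (V :|: W) (E :|: F).
Proof.
move=> wE wF e /setUP[/wE|/wF] se; apply: subset_trans se _.
  exact: subsetUl.
exact: subsetUr.
Qed.

Lemma within_walk V E r p : r \in V -> within V E ->
  within (V :|: [set y in p]) (E :|: walk_edges r p).
Proof.
move=> rV wE; have := within_setU wE (@walk_edges_within r p).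
suff -> : V :|: [set y in r :: p] = V :|: [set y in p] by [].
by apply/setP=> y; rewrite !inE; case: eqP => //= ->; rewrite rV.
Qed.

Lemma setU_cons V z p : V :|: [set y in z :: p] = (z |: V) :|: [set y in p].
Proof. by apply/setP=> y; rewrite !inE orbCA orbA. Qed.

Lemma setU_walk_cons E r z p :
  E :|: walk_edges r (z :: p) = ([set r; z] |: E) :|: walk_edges z p.
Proof. by rewrite walk_edges_cons setUCA setUA. Qed.

Lemma within_pendant V E r z : r \in V -> within V E ->
  within (z |: V) ([set r; z] |: E).
Proof.
move=> rV wE; have := @within_walk V E r [:: z] rV wE.
by rewrite setU_walk_cons walk_edges_nil setU0 setU_cons set_nil setU0.
Qed.

Lemma disjoint_setU1 V z p : uniq (z :: p) -> [disjoint z :: p & V] ->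
  [/\ z \notin V, uniq p & [disjoint p & z |: V]].
Proof.
rewrite disjoint_cons => /andP[zp Up] /andP[zV dV]; split=> //.
rewrite disjoint_has; apply/hasPn=> y yp; rewrite !inE negb_or.
rewrite (disjointFr dV yp) andbT.
by apply: contraNneq zp => <-.
Qed.

Lemma ntrees_pendant_path V E r p :
  r \in V -> within V E -> uniq p -> [disjoint p & V] ->
  ntrees (V :|: [set y in p]) (E :|: walk_edges r p) = ntrees V E.
Proof.
elim: p V E r => [|z p IHp] V E r rV wE Up dV.
  by rewrite walk_edges_nil set_nil !setU0.
have [zV Up' dV'] := disjoint_setU1 Up dV.
rewrite setU_cons setU_walk_cons IHp ?ntrees_pendant ?setU11 //.
exact: within_pendant.
Qed.

(** The tree count stays constant while the path grows, so each new vertex contributes the same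
    [ntrees V E]. *)
Lemma nbitrees_pendant_path V E r s p :
  r \in V -> s \in V -> within V E -> uniq p -> [disjoint p & V] ->
  nbitrees (last r p) s (V :|: [set y in p]) (E :|: walk_edges r p)
  = size p * ntrees V E + nbitrees r s V E.
Proof.
elim: p V E r => [|z p IHp] V E r rV sV wE Up dV.
  by rewrite walk_edges_nil set_nil !setU0.
have [zV Up' dV'] := disjoint_setU1 Up dV.
rewrite setU_cons setU_walk_cons /= IHp ?setU11 //.
- by rewrite ntrees_pendant // nbitrees_pendant // mulSn addnCA addnA.
- by rewrite inE sV orbT.
- exact: within_pendant.
Qed.

(** * Attaching an ear *)

Section Ear.

Variables (V : {set T}) (E : {set {set T}}) (r s : T) (p : seq T).
Hypotheses (rV : r \in V) (sV : s \in V) (wE : within V E).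
Hypotheses (Up : uniq p) (dV : [disjoint p & V]).
(* For [r = s] the ear is a closed cycle, which must have at least 3 edges. *)
Hypothesis szp : (r == s) < size p.

Let notp v : v \in V -> v \notin p.
Proof. by move=> vV; apply/negP=> vp; rewrite (disjointFr dV vp) in vV. Qed.

(** An edge of the ear with an end in [p] is not in [E]. It can recur on one of the two pieces only
    if [r = s] and it closes that piece, which [walk_edges_chord] excludes. *)
Lemma ear_edge_fresh p1 p2 : p = p1 ++ p2 ->
  [set last r p1; head s p2]
    \notin E :|: (walk_edges r p1 :|: walk_edges s (rev p2)).
Proof.
move=> pE.
have [p1V p2V] : {in V, forall v, v \notin p1} /\ {in V, forall v, v \notin p2}.
  by split=> v /notp; rewrite pE mem_cat negb_or => /andP[].
have [Up1 p12 Up2] : [/\ uniq p1, {in p2, forall v, v \notin p1} & uniq p2].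
  move: Up; rewrite pE cat_uniq => /and3P[-> /hasPn p12 ->].
  by split.
rewrite !inE !negb_or; apply/and3P; split.
- apply/negP=> /wE; rewrite subUset !sub1set => /andP[].
  case: p1 p1V pE {p12 Up1} => [|u p1] p1V pE /=; last first.
    by move=> /p1V; rewrite mem_last.
  case: p2 p2V pE {Up2} => [|v p2] p2V pE /=; last first.
    by move=> _ /p2V; rewrite mem_head.
  by move: szp; rewrite pE ltn0.
- apply/negP=> in1; have := walk_edges_within in1.
  rewrite subUset !sub1set !inE => /andP[_].
  (* The far end must lie on [r :: p1]; this leaves only [p2] empty and [s = r], where [szp]
     provides two vertices on [p1]. *)
  case: p2 p12 p2V pE in1 {Up2} => [|v p2] /= p12 p2V pE in1.
    rewrite (negPf (p1V s sV)) orbF => /eqP sr.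
    rewrite sr in in1.
    suff: [set last r p1; r] \notin walk_edges r p1 by rewrite in1.
    apply: walk_edges_chord.
      by rewrite cons_uniq p1V.
    by move: szp; rewrite pE cats0 sr eqxx.
  rewrite (negPf (p12 v (mem_head _ _))) orbF => /eqP vr.
  by have := p2V r rV; rewrite -vr mem_head.
apply/negP=> in2; have := walk_edges_within in2.
rewrite subUset !sub1set !inE => /andP[+ _].
rewrite mem_rev.
case: (lastP p1) p12 p1V pE in2 {Up1} => [|q u] /= p12 p1V pE in2.
  rewrite (negPf (p2V r rV)) orbF => /eqP rs.
  have hE : last s (rev p2) = head s p2.
    by case: (p2) => // v q; rewrite rev_cons last_rcons.
  rewrite rs setUC -hE in in2.
  suff: [set last s (rev p2); s] \notin walk_edges s (rev p2).
    by rewrite in2.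
  apply: walk_edges_chord.
    by rewrite cons_uniq mem_rev p2V // rev_uniq.
  by move: szp; rewrite size_rev pE rs eqxx.
rewrite last_rcons => /orP[/eqP us|up2].
  by have := p1V s sV; rewrite -us mem_rcons mem_head.
by have := p12 u up2; rewrite mem_rcons mem_head.
Qed.

Lemma ear_setE p1 p2 : p = p1 ++ p2 ->
  E :|: walk_edges r (rcons p s)
  = [set last r p1; head s p2]
      |: (E :|: (walk_edges r p1 :|: walk_edges s (rev p2))).
Proof. by move=> ->; rewrite walk_edges_split setUCA. Qed.

Lemma ntrees_ear_delete p1 p2 : p = p1 ++ p2 ->
  ntrees (V :|: [set y in p]) (E :|: (walk_edges r p1 :|: walk_edges s (rev p2)))
  = ntrees V E.
Proof.
move=> pE; have := Up; have := dV; rewrite pE disjoint_cat cat_uniq.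
case/andP=> d1 d2 /and3P[Up1 /hasPn p12 Up2].
(* The piece at [s] is listed in reverse so that both pieces grow outwards from [V]. *)
have -> : V :|: [set y in p1 ++ p2]
          = (V :|: [set y in p1]) :|: [set y in rev p2].
  by apply/setP=> y; rewrite !inE mem_cat mem_rev orbA.
rewrite setUA ntrees_pendant_path ?ntrees_pendant_path ?rev_uniq //.
- by rewrite inE sV.
- exact: within_walk.
rewrite disjoint_has has_rev -disjoint_has disjoint_has.
apply/hasPn=> y yp; rewrite !inE negb_or (disjointFr d2 yp).
exact: p12.
Qed.

Lemma ntrees_ear :
  ntrees (V :|: [set y in p]) (E :|: walk_edges r (rcons p s))
  = (size p).+1 * ntrees V E + nbitrees r s V E.
Proof.
(* The edge singled out is the one arriving at [s]: trees avoiding it give one [ntrees V E], and the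
   pendant path from [r] gives [size p] more. *)
have pE : p = p ++ [::] by rewrite cats0.
rewrite (ear_setE pE) ntrees_setU1.
- rewrite ntrees_ear_delete //=.
  by rewrite walk_edges_nil setU0 nbitrees_pendant_path // mulSn addnA.
- by have := mem_last r p; rewrite !inE => /orP[/eqP->|->]; rewrite ?rV ?orbT.
- case: (lastP p) szp notp => [|q u] // _ nu.
  rewrite last_rcons; apply: contraTneq (nu s sV) => ->.
  by rewrite negbK mem_rcons mem_head.
exact: ear_edge_fresh.
Qed.

(** The trees avoiding [uv] are those of the ear with that edge deleted. The forests may be counted
    with [uv] still present, since none of them contains it. *)
Lemma nbitrees_ear_edge u v :
  u \in V :|: [set y in p] -> u != v -> [set u; v] \in walk_edges r (rcons p s) ->
  ntrees (V :|: [set y in p]) (E :|: walk_edges r (rcons p s))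
  = ntrees V E
    + nbitrees u v (V :|: [set y in p]) (E :|: walk_edges r (rcons p s)).
Proof.
move=> uV' neq_uv /walk_edges_rconsP[p1 [p2 [pE uvE]]].
rewrite (ear_setE pE) -uvE; have := ear_edge_fresh pE; rewrite -uvE => fresh.
by rewrite ntrees_setU1 // nbitrees_setU1 // ntrees_ear_delete.
Qed.

End Ear.

End Ears.

(** * The counts for accordions and their recurrence *)

Lemma ntrees_point (T : finType) (x : T) : ntrees [set x] set0 = 1.
Proof.
rewrite /ntrees /subset_count -(cards1 (set0 : {set {set T}})).
apply: eq_card => F; rewrite !inE subset0.
case: eqP => //= ->; apply/andP; split.
  by apply/(connectedP _ (set11 x)) => v /set1P->; apply: connect0.
apply/acyclicP=> -[|a [|b c]] // _ _; apply/negP=> /=.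
by rewrite /adj inE.
Qed.

(* The components count the spanning trees of a [(k, n)]-accordion and those
   among them through a given free edge; a single free edge serves as the
   [(k, 0)]-accordion. *)
Fixpoint accordion_counts (k n : nat) : nat * nat :=
  if n is m.+1 then
    let: (t, c) := accordion_counts k m in ((k - 1) * t + c, (k - 2) * t + c)
  else (1, 1).

Lemma accordion_countsE k n : 1 < k ->
  (accordion_counts k n.+1).1
  = (accordion_counts k n).1 + (accordion_counts k n.+1).2.
Proof.
move=> k_gt1 /=; case: (accordion_counts k n) => t c /=.
by rewrite addnA -mulSn -subSn.
Qed.

(** Write [t] and [c] for the two components. Add [t_n] to [t_(n+2) = (k - 1) t_(n+1) + c_(n+1)] and
    use [c_(n+1) + t_n = t_(n+1)]. The additive form avoids truncated subtraction. *)
Lemma accordion_counts_rec k n : 1 < k ->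
  (accordion_counts k n.+2).1 + (accordion_counts k n).1
  = k * (accordion_counts k n.+1).1.
Proof.
move=> k_gt1; have := accordion_countsE n k_gt1.
have -> : (accordion_counts k n.+2).1
          = (k - 1) * (accordion_counts k n.+1).1 + (accordion_counts k n.+1).2.
  by rewrite /=; case: (accordion_counts k n).
rewrite -addnA (addnC (accordion_counts k n.+1).2) => <-.
by rewrite -mulSnr -subSn ?subn1 // ltnW.
Qed.

Lemma within_edges (T : finType) (G : sgraph T) : within (vertices G) (edges G).
Proof. by move=> e /edgesP[]. Qed.

Lemma edge_ends (T : finType) (G : sgraph T) (r s : T) :
  [set r; s] \in edges G ->
  [/\ r \in vertices G, s \in vertices G & r != s].
Proof.
case/edgesP; rewrite subUset !sub1set cards2 => /andP[-> ->].
by case: (r == s).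
Qed.

Lemma accordion_free_edges (T : finType) k n (G : sgraph T) fr :
  accordion_free k n G fr -> fr \subset edges G.
Proof. by case=> // *; apply/subsetP=> e; rewrite inE => /andP[]. Qed.

(** Induction on the construction. The second conjunct ranges over all free edges because the next
    cycle may be glued to any of them. *)
Lemma accordion_free_counts (T : finType) k n (G : sgraph T) fr : 2 < k ->
  accordion_free k n G fr ->
  tau G = (accordion_counts k n).1 /\
  forall r s, [set r; s] \in fr ->
    nbitrees r s (vertices G) (edges G) = (accordion_counts k n).2.
Proof.
move=> k_gt2.
have k_gt1 := ltnW k_gt2.
elim=> {n G fr} [G x p Up szp VG EG|n G G' fr r s p accG IH rs_fr Up szp dp VG EG].
  have szp' : size p = k - 1 by rewrite -szp subn1.
  have [xp Up'] := andP Up.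
  have VE : [set y in x :: p] = [set x] :|: [set y in p].
    by apply/setP=> y; rewrite !inE.
  have EE : walk_edges x (rcons p x) = set0 :|: walk_edges x (rcons p x).
    by rewrite set0U.
  have w0 : within [set x] (set0 : {set {set T}}) by move=> e; rewrite inE.
  have dp : [disjoint p & [set x]].
    rewrite disjoint_has; apply/hasPn=> y yp; rewrite !inE.
    by apply: contraNneq xp => <-.
  have sz : (x == x) < size p by rewrite eqxx szp' ltn_subRL addn1.
  have tE : tau G = k.
    rewrite -[LHS]/(ntrees _ _) VG EG VE EE.
    rewrite (ntrees_ear (set11 x) (set11 x) w0 Up' dp sz) ntrees_point szp'.
    (* With [r = s] there are no two-component forests, so only [(size p).+1 = k] remains. *)
    rewrite /nbitrees subset_count_pred0 => [|F _]; last exact: bitree_diag.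
    by rewrite addn0 muln1 subn1 prednK // ltnW.
  split; first by rewrite tE /= muln1 subn1 addn1 prednK // ltnW.
  move=> r s rsG; have [rV sV neq_rs] := edge_ends rsG.
  move: rsG rV; rewrite VG EG VE => rsE rV.
  have := nbitrees_ear_edge (set11 x) (set11 x) w0 Up' dp sz rV neq_rs rsE.
  (* Exactly one of the [k] trees avoids a given edge of the cycle, which leaves [k - 1]. *)
  rewrite -EE -VE -EG -VG -[LHS]/(tau G) tE ntrees_point /=.
  rewrite muln1 addn1 -subSn // => kE; apply/eqP.
  by rewrite -(eqn_add2l 1) -kE add1n subSS subn1 prednK // ltnW.
have [tG cG] := IH; have rsE := subsetP (accordion_free_edges accG) _ rs_fr.
have [rV sV neq_rs] := edge_ends rsE.
have sz : (r == s) < size p by rewrite (negPf neq_rs) szp subn_gt0.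
have wE := @within_edges _ G.
have tG' : tau G' = (accordion_counts k n.+1).1.
  rewrite -[LHS]/(ntrees _ _) VG EG.
  rewrite (ntrees_ear rV sV wE Up dp sz).
  rewrite (cG _ _ rs_fr) -[ntrees _ _]/(tau G) tG szp.
  by rewrite /= -subSn //; case: (accordion_counts k n) => t c.
split=> // u v; rewrite inE => /andP[uvE /exists_inP[y yuv yp]].
have [uV' _ neq_uv] := edge_ends uvE.
(* A free edge contains a new vertex [y], whereas the edges of [G] stay inside [vertices G]. *)
have uvW : [set u; v] \in walk_edges r (rcons p s).
  move: uvE; rewrite EG in_setU => /orP[/wE/subsetP/(_ y yuv)|//].
  by rewrite (disjointFr dp yp).
rewrite VG in uV'.
have := nbitrees_ear_edge rV sV wE Up dp sz uV' neq_uv uvW.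
rewrite -VG -EG -[LHS]/(tau G') tG' -[ntrees _ _]/(tau G) tG.
by rewrite accordion_countsE // => /addnI.
Qed.

(** * Existence of accordions *)

Lemma accordion_cycle_exists (T : finType) k : 2 < k -> k <= #|T| ->
  exists (G : sgraph T) (fr : {set {set T}}) (r s : T),
    [/\ accordion_free k 1 G fr, [set r; s] \in fr & #|vertices G| <= k * 1].
Proof.
move=> k_gt2 leT.
have [x [p [Up szp]]] : exists x p, uniq (x :: p : seq T) /\ size (x :: p) = k.
  have : uniq (take k (enum T)) by rewrite take_uniq ?enum_uniq.
  have : size (take k (enum T)) = k by rewrite size_takel // -cardE.
  case: (take k (enum T)) => [k0|x p *]; first by rewrite -k0 in k_gt2.
  by exists x, p.
have edP e : e \in walk_edges x (rcons p x) ->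
    e \subset [set y in x :: p] /\ #|e| = 2.
  rewrite walk_edges_rcons in_setU1 => /orP[/eqP->|ep]; last first.
    split; [exact: walk_edges_within ep | exact: card_walk_edges ep].
  split; first by rewrite subUset !sub1set !in_set mem_last mem_head.
  rewrite cards2; case: (lastP p) szp Up => [|q y] /=.
    by move=> k1; rewrite -k1 in k_gt2.
  by rewrite last_rcons mem_rcons inE negb_or eq_sym => _ /andP[/andP[->]].
exists (SGraph edP), (walk_edges x (rcons p x)), (last x p), x; split.
- exact: (@AccordionCycle _ _ (SGraph edP) x p).
- by rewrite walk_edges_rcons setU11.
by rewrite muln1 -szp cardsE card_size.
Qed.

Lemma accordion_exists (T : finType) k n : 2 < k -> k * n.+1 <= #|T| ->
  exists (G : sgraph T) (fr : {set {set T}}) (r s : T),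
    [/\ accordion_free k n.+1 G fr, [set r; s] \in fr & #|vertices G| <= k * n.+1].
Proof.
move=> k_gt2; elim: n => [|n IHn] leT.
  by apply: accordion_cycle_exists => //; rewrite muln1 in leT.
have [|G [fr [r [s [accG rs_fr cardV]]]]] := IHn.
  by apply: leq_trans leT; rewrite leq_mul2l leqnSn orbT.
have [rV sV neq_rs] := edge_ends (subsetP (accordion_free_edges accG) _ rs_fr).
pose p := take (k - 2) (enum (~: vertices G)).
have szp : size p = k - 2.
  rewrite size_takel // -cardE cardsCs setCK leq_subRL; last first.
    exact: max_card.
  by apply: leq_trans leT; rewrite mulnS addnC leq_add ?leq_subr.
have Up : uniq p by rewrite take_uniq ?enum_uniq.
have pV y : y \in p -> y \notin vertices G.
  by move/mem_take; rewrite mem_enum inE.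
have dp : [disjoint p & vertices G] by rewrite disjoint_has; apply/hasPn.
have notp v : v \in vertices G -> v \notin p.
  by move=> vV; apply: contraL vV => /pV.
have p_gt0 : 0 < size p by rewrite szp subn_gt0.
have edP e : e \in edges G :|: walk_edges r (rcons p s) ->
    e \subset vertices G :|: [set y in p] /\ #|e| = 2.
  rewrite in_setU => /orP[/edgesP[se ->]|ep].
    by split=> //; apply: subset_trans se (subsetUl _ _).
  split; last first.
    apply: card_walk_edges ep; rewrite /= mem_rcons inE negb_or neq_rs notp //.
    by rewrite rcons_uniq Up notp.
  apply: subset_trans (walk_edges_within ep) _; apply/subsetP=> y.
  by rewrite !inE mem_rcons inE => /or3P[/eqP->|/eqP->|->]; rewrite ?rV ?sV ?orbT.
have accG' := @AccordionStep T k n.+1 G (SGraph edP) fr r s p accG rs_fr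
  Up szp dp erefl erefl.
(* The edge handed to the next step is the last one of the ear; it is free because [p] is nonempty,
   so [last r p] is a new vertex. *)
exists (SGraph edP); eexists; exists (last r p), s; split; first exact: accG'.
  rewrite inE /= walk_edges_rcons !inE eqxx orbT.
  apply/exists_inP; exists (last r p); first exact: set21.
  by case: (lastP p) p_gt0 => // q u _; rewrite last_rcons mem_rcons mem_head.
rewrite /= (leq_trans (leq_card_setU _ _)) // mulnSr leq_add //.
by rewrite cardsE (leq_trans (card_size _)) // szp leq_subr.
Qed.

Theorem theorem2 :
  exists tauA : nat -> nat -> nat,
    (forall k n : nat, 3 <= k -> 1 <= n ->
       (exists (T : finType) (G : sgraph T), accordion k n G) /\
       (forall (T : finType) (G : sgraph T),
          accordion k n G -> tau G = tauA k n)) /\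
    (forall k n : nat, 3 <= k -> 3 <= n ->
       ((tauA k n)%:Z =
          k%:Z * (tauA k (n - 1)%N)%:Z - (tauA k (n - 2)%N)%:Z)%R).
Proof.
exists (fun k n => (accordion_counts k n).1); split=> k [|n] // k_ge3.
  move=> _; split=> [|T G [fr accG]].
    have [|G [fr [_ [_ [accG _ _]]]]] := @accordion_exists 'I_(k * n.+1) k n k_ge3.
      by rewrite card_ord.
    by exists 'I_(k * n.+1), G, fr.
  by have [] := accordion_free_counts k_ge3 accG.
case: n => [|n] // _; rewrite !subSS !subn0.
(* The subtraction takes place only here, in the integers. *)
by rewrite -PoszM -(accordion_counts_rec n (ltnW k_ge3)) PoszD GRing.addrK.
Qed.
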